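(* For any complete graph $K_n$ of even order $n$, $EC(K_n)\ge 2(n-1)$.
   Context: Graphs are finite and simple; the order is the number of vertices. Two distinct edges are adjacent if they share an endpoint. A set $D\subseteq E$ is an edge-dominating set of $G=(V,E)$ if every edge in $E\setminus D$ is adjacent to an edge of $D$. Two disjoint sets of edges $E_1,E_2$ form an edge coalition if neither is an edge-dominating set but $E_1\cup E_2$ is. An $ec$-partition of $G$ is a partition $\pi=\{E_1,\ldots,E_k\}$ of $E$ into nonempty sets such that every $E_i$ is either a singleton edge-dominating set, or is not an edge-dominating set but forms an edge coalition with another set $E_j$ of $\pi$. The edge coalition number $EC(G)$ is the maximum order $k$ of an $ec$-partition of $G$.
   Formalization: The order n is assumed greater than 2: for n = 2 the claim fails, since K_2 has a single edge, so EC(K_2) = 1 < 2 = 2(n-1). *)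

(* Defs.v *)
From HB Require Import structures.
From mathcomp Require Import all_boot.

Set Implicit Arguments.
Unset Strict Implicit.
Unset Printing Implicit Defensive.

Record sgraph := SGraph {
  vertex :> finType;
  adj : rel vertex;
  adj_sym : symmetric adj;
  adj_irr : irreflexive adj
}.

Section EdgeCoalition.
Variable G : sgraph.

(* An edge is the two-element set of its endpoints. *)
Definition edges : {set {set G}} := [set [set x; y] | x in G, y in G & adj x y].

Definition edge_adj : rel {set G} := fun e f => (e != f) && (e :&: f != set0).

Definition edge_dominating (D : {set {set G}}) : bool :=
  (D \subset edges) &&
  [forall e in edges :\: D, exists f in D, edge_adj e f].

Definition edge_coalition (A B : {set {set G}}) : bool :=
  [&& [disjoint A & B], ~~ edge_dominating A, ~~ edge_dominating B
    & edge_dominating (A :|: B)].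

(* Nonemptiness of the parts is included in partition. *)
Definition ec_partition (P : {set {set {set G}}}) : bool :=
  partition P edges &&
  [forall A in P,
     (#|A| == 1) && edge_dominating A
     || ~~ edge_dominating A && [exists B in P :\ A, edge_coalition A B]].

(* The value is 0 when G has no ec-partition. *)
Definition edge_coalition_number : nat :=
  \max_(P : {set {set {set G}}} | ec_partition P) #|P|.

End EdgeCoalition.

Lemma neq_sym_rel (T : eqType) : symmetric (fun x y : T => x != y).
Proof. by move=> x y; rewrite eq_sym. Qed.

Lemma neq_irr_rel (T : eqType) : irreflexive (fun x y : T => x != y).
Proof. by move=> x; rewrite eqxx. Qed.

Definition complete_graph (n : nat) : sgraph :=
  @SGraph 'I_n (fun x y => x != y) (@neq_sym_rel _) (@neq_irr_rel _).

(* Main.v *)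
Require Import Defs.
From mathcomp Require Import all_boot.
From mathcomp Require Import ssralg zmodp.
Import GRing.Theory.

Set Implicit Arguments.
Unset Strict Implicit.
Unset Printing Implicit Defensive.

(** The complete graph of even order n has a 1-factorization, that is, a
    partition of its edges into n - 1 perfect matchings.  A perfect matching F
    is edge-dominating, but no proper subset of F is: both ends of a removed
    edge are left uncovered, so nothing dominates that edge any more.  Since
    n > 2, F has at least two edges, and cutting it into two nonempty pieces
    yields an edge coalition.  Doing so for each of the n - 1 matchings gives
    an ec-partition with 2(n - 1) parts.

    The classical 1-factorization takes Z/m, with m = n - 1 odd, together with
    a point at infinity as vertices; the matching attached to x consists of the
    edge from x to infinity and of the pairs {a, b} with a + b = 2x, that is,
    the pairs exchanged by the reflection about x.  As m is odd, x is the only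
    fixed point of this reflection, and x |-> 2x is a bijection, so that each
    edge lies in exactly one matching.  Each matching is cut into its edge
    through infinity and the rest.  The parts are then exactly the fibres of
    one labelling of the edges: whether infinity is an end, and the sum of the
    ends, infinity counting for 0 (lemma [ec_partition_parts]). *)

(** * Fibre partitions *)

Section Fibres.
Variables (T I : finType) (f : T -> I) (D : {set T}).

Definition fibre (i : I) : {set T} := [set x in D | f x == i].
Definition fibres : {set {set T}} := [set fibre i | i : I].

Hypothesis fibre_neq0 : forall i, fibre i != set0.

Lemma fibre_inj : injective fibre.
Proof.
move=> i j eq_ij; have /set0Pn[x xi] := fibre_neq0 i.
have: x \in fibre j by rewrite -eq_ij.
by move: xi; rewrite !inE => /andP[_ /eqP <-] /andP[_ /eqP].
Qed.

Lemma card_fibres : #|fibres| = #|I|.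
Proof. by rewrite card_imset //; exact: fibre_inj. Qed.

Lemma disjoint_fibre i j : i != j -> [disjoint fibre i & fibre j].
Proof.
move=> neq_ij; apply/pred0P => x; rewrite /= !inE.
by apply: contraNF neq_ij => /andP[/andP[_ /eqP<-] /andP[_ /eqP<-]].
Qed.

Lemma partition_fibres : partition fibres D.
Proof.
apply/and3P; split.
- rewrite eqEsubset; apply/andP; split; apply/subsetP => x.
    by move=> /bigcupP[_ /imsetP[i _ ->]]; rewrite inE => /andP[].
  move=> Dx; apply/bigcupP; exists (fibre (f x)); first exact: imset_f.
  by rewrite inE Dx eqxx.
- apply/trivIsetP => _ _ /imsetP[i _ ->] /imsetP[j _ ->] neq_ij.
  by apply: disjoint_fibre; apply: contraNneq neq_ij => ->.
- by apply/imsetP => -[i _ /esym/eqP]; apply/negP.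
Qed.

End Fibres.

(** * Edge domination in complete graphs *)

Lemma edge_coalition_sym (G : sgraph) (A B : {set {set G}}) :
  edge_coalition A B = edge_coalition B A.
Proof.
by rewrite /edge_coalition disjoint_sym setUC; congr (_ && _); exact: andbCA.
Qed.

Section Domination.
Variable n : nat.
Notation K := (complete_graph n).
Implicit Types (x y : K) (D : {set {set K}}).

Lemma edges_completeP (e : {set K}) :
  reflect (exists x y, x != y /\ e = [set x; y]) (e \in edges K).
Proof.
apply: (iffP imset2P) => [[x y _] | [x [y [neq_xy ->]]]].
  by rewrite inE => /andP[_ neq_xy] ->; exists x, y.
by exists x y; rewrite ?inE.
Qed.

Lemma edge_complete x y : x != y -> [set x; y] \in edges K.
Proof. by move=> neq_xy; apply/edges_completeP; exists x, y. Qed.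

(** Every edge outside [D] has an end, which is covered by an edge of [D]. *)
Lemma edge_dominating_cover D : D \subset edges K ->
  (forall x, exists2 f, f \in D & x \in f) -> edge_dominating D.
Proof.
move=> sDE covD; rewrite /edge_dominating sDE /=.
apply/forall_inP => e /setDP[/edges_completeP[x [y [neq_xy ->]]] nDe].
have [f Df fx] := covD x; apply/exists_inP; exists f => //.
apply/andP; split; first by apply: contraNneq nDe => ->.
by apply/set0Pn; exists x; rewrite !inE eqxx fx.
Qed.

(** The edge joining two uncovered vertices meets no edge of [D]. *)
Lemma edge_dominatingN D x y : x != y ->
  {in D, forall f : {set K}, x \notin f /\ y \notin f} -> ~~ edge_dominating D.
Proof.
move=> neq_xy uncov; apply/nandP; right; apply/forall_inPn.
exists [set x; y] => [|].
  rewrite inE edge_complete // andbT; apply/negP => /uncov[].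
  by rewrite !inE eqxx.
apply/exists_inPn => f /uncov[nfx nfy]; rewrite negb_and; apply/orP; right.
rewrite negbK; apply/eqP/setP => z; rewrite !inE; apply/negP => /andP[].
by case/orP => /eqP ->; apply/negP.
Qed.

End Domination.

(** * Cutting the matchings of the 1-factorization *)

Section Factorization.
Variable p : nat.
Hypothesis p_even : ~~ odd p.
Notation m := p.+1.
Notation K := (complete_graph m.+1).
Local Open Scope ring_scope.

Lemma Zp_mulrn_order (x : 'I_m) : x *+ m = 0.
Proof. by apply: val_inj; rewrite Zp_mulrn /= modnMl. Qed.

(** The order [m] is odd, so the multiplier [p./2.+1] is (m + 1) / 2, the
    inverse of 2 modulo [m]. *)
Definition half (x : 'I_m) : 'I_m := x *+ p./2.+1.

Lemma doubleK : cancel (fun x : 'I_m => x + x) half.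
Proof.
move=> x; rewrite /half -mulr2n -mulrnA mul2n doubleS even_halfK //.
by rewrite mulrS Zp_mulrn_order addr0.
Qed.

Lemma halfK : cancel half (fun x : 'I_m => x + x).
Proof. by move=> x; rewrite /half -mulrnDl; exact: doubleK. Qed.

Definition infty : K := ord_max.
Definition pt (x : 'I_m) : K := lift ord_max x.

(** Reducing modulo [m] sends [infty], whose value is [m], to 0, so that one
    formula gives the second component for all edges. *)
Definition edge_label (e : {set K}) : bool * 'I_m :=
  (infty \in e, \sum_(v in e) inZp (v : 'I_m.+1)).

Definition part : bool * 'I_m -> {set {set K}} := fibre edge_label (edges K).

Lemma pt_neq_infty x : (pt x == infty) = false.
Proof. by apply/negbTE; rewrite eq_sym neq_lift. Qed.

Lemma pt_eq x y : (pt x == pt y) = (x == y).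
Proof. by apply/inj_eq/lift_inj. Qed.

(** For case analysis of a vertex as the point at infinity or an element of
    Z/m. *)
Variant vertex_spec : K -> Type :=
  | VertexInfty : vertex_spec infty
  | VertexPt x : vertex_spec (pt x).

Lemma vertexP v : vertex_spec v.
Proof. by case: (unliftP (ord_max : 'I_m.+1) v) => [x ->|->]; constructor. Qed.

Lemma inZp_pt x : inZp (pt x : 'I_m.+1) = x.
Proof. by apply: val_inj; rewrite /= /bump leqNgt ltn_ord add0n modn_small. Qed.

Lemma inZp_infty : inZp (infty : 'I_m.+1) = 0 :> 'I_m.
Proof. by apply: val_inj; rewrite /= modnn. Qed.

Lemma label_spoke x : edge_label [set infty; pt x] = (true, x).
Proof.
rewrite /edge_label !inE eqxx big_setU1 ?inE 1?eq_sym ?pt_neq_infty //=.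
by rewrite big_set1 inZp_pt inZp_infty add0r.
Qed.

Lemma label_chord x y : x != y -> edge_label [set pt x; pt y] = (false, x + y).
Proof.
move=> neq_xy; rewrite /edge_label !inE ![infty == _]eq_sym !pt_neq_infty.
by rewrite big_setU1 ?inE ?pt_eq //= big_set1 !inZp_pt.
Qed.

Lemma spoke_in_part x : [set infty; pt x] \in part (true, x).
Proof.
by rewrite inE label_spoke eqxx edge_complete // eq_sym pt_neq_infty.
Qed.

Lemma chord_in_part x y : x != y -> [set pt x; pt y] \in part (false, x + y).
Proof. by move=> neq; rewrite inE label_chord // eqxx edge_complete ?pt_eq. Qed.

Lemma spoke_partP x e : e \in part (true, x) -> e = [set infty; pt x].
Proof.
rewrite inE => /andP[/edges_completeP[u [v [neq_uv ->]]]].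
case/vertexP: u neq_uv => [|y]; case/vertexP: v => [|z] neq_uv.
- by rewrite eqxx in neq_uv.
- by rewrite label_spoke => /eqP[->].
- by rewrite setUC label_spoke => /eqP[->].
- by rewrite label_chord // -pt_eq.
Qed.

Lemma chord_partP k e : e \in part (false, k) ->
  exists x y, [/\ x != y, x + y = k & e = [set pt x; pt y]].
Proof.
rewrite inE => /andP[/edges_completeP[u [v [neq_uv ->]]]].
case/vertexP: u neq_uv => [|y]; case/vertexP: v => [|z] neq_uv.
- by rewrite eqxx in neq_uv.
- by rewrite label_spoke.
- by rewrite setUC label_spoke.
- rewrite pt_eq in neq_uv; rewrite label_chord // => /eqP[<-].
  by exists y, z.
Qed.

(** The reflection about [x] moves every other point, [m] being odd. *)
Lemma reflection_neq (x y : 'I_m) : y != x -> y != x + x - y.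
Proof.
apply: contra_neq => eq_y; apply: (can_inj doubleK).
by rewrite /= {2}eq_y addrC subrK.
Qed.

Lemma reflected_chord_in_part (x y : 'I_m) : y != x ->
  [set pt y; pt (x + x - y)] \in part (false, x + x).
Proof.
by move=> /reflection_neq/chord_in_part; rewrite [y + _]addrC subrK.
Qed.

Lemma part_sub l : part l \subset edges K.
Proof. by apply/subsetP => e; rewrite inE => /andP[]. Qed.

(** The matching of [x] covers [x] and infinity by one edge, and any other
    point by the chord to its reflection about [x]. *)
Lemma dominating_matching x :
  edge_dominating (part (true, x) :|: part (false, x + x)).
Proof.
apply: edge_dominating_cover => [|v]; first by rewrite subUset !part_sub.
case/vertexP: v => [|y].
  exists [set infty; pt x]; last by rewrite !inE eqxx.
  by apply/setUP; left; exact: spoke_in_part.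
have [-> | neq_yx] := eqVneq y x.
  exists [set infty; pt x]; last by rewrite !inE eqxx orbT.
  by apply/setUP; left; exact: spoke_in_part.
exists [set pt y; pt (x + x - y)]; last by rewrite !inE eqxx.
by apply/setUP; right; exact: reflected_chord_in_part.
Qed.

Hypothesis p_gt1 : (1 < p)%N.

Lemma two_other_points (x : 'I_m) : exists y z, [/\ y != x, z != x & y != z].
Proof.
have /card_gt1P[y [z [yx zx neq_yz]]] : (1 < #|[set~ x]|)%N.
  by rewrite cardsC1 card_ord.
by exists y, z; split=> //; [move: yx | move: zx]; rewrite !inE.
Qed.

Lemma part_neq0 l : part l != set0.
Proof.
case: l => [[] k]; apply/set0Pn; first by eexists; exact: spoke_in_part.
have [y [_ [neq_y _ _]]] := two_other_points (half k).
have := reflected_chord_in_part neq_y.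
by rewrite halfK => yk; eexists; exact: yk.
Qed.

(** A single edge leaves at least two vertices uncovered, since the graph has
    at least four. *)
Lemma spoke_part_nondominating x : ~~ edge_dominating (part (true, x)).
Proof.
have [y [z [neq_yx neq_zx neq_yz]]] := two_other_points x.
apply: (@edge_dominatingN _ _ (pt y) (pt z)) => [|e /spoke_partP ->].
  by rewrite pt_eq.
by rewrite !inE !pt_neq_infty !pt_eq (negPf neq_yx) (negPf neq_zx).
Qed.

(** The chords exchanged by the reflection about [x] miss its centre [x] and
    infinity. *)
Lemma chord_part_nondominating x : ~~ edge_dominating (part (false, x + x)).
Proof.
apply: (@edge_dominatingN _ _ infty (pt x)) => [|e /chord_partP].
  by rewrite eq_sym pt_neq_infty.
move=> [y [z [neq_yz eq_yz ->]]].
rewrite !inE ![infty == _]eq_sym !pt_neq_infty !pt_eq; split=> //.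
(* if x were y or z, then y + z = x + x would give y = z *)
apply/norP; split; apply: contra_neqN neq_yz => /eqP eq_x.
  by apply: (addrI y); rewrite eq_yz eq_x.
by apply: (addIr z); rewrite eq_yz eq_x.
Qed.

Lemma coalition_matching x :
  edge_coalition (part (true, x)) (part (false, x + x)).
Proof.
apply/and4P; split.
- by rewrite /part disjoint_fibre.
- exact: spoke_part_nondominating.
- exact: chord_part_nondominating.
- exact: dominating_matching.
Qed.

(** Doubling is a bijection of Z/m, so every class of chords has a centre and
    hence a spoke as partner. *)
Lemma ec_partition_parts : ec_partition (fibres edge_label (edges K)).
Proof.
rewrite /ec_partition (partition_fibres part_neq0) /=.
apply/forall_inP => _ /imsetP[l _ ->]; rewrite -/(part l).
apply/orP; right.
suff [l' neq_l coal] : exists2 l', l' != l & edge_coalition (part l) (part l').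
  have /and4P[_ -> _ _] := coal; apply/exists_inP; exists (part l') => //.
  by rewrite !inE (inj_eq (fibre_inj part_neq0)) neq_l imset_f.
case: l => [[] k].
  by exists (false, k + k) => //; exact: coalition_matching.
exists (true, half k) => //.
by rewrite edge_coalition_sym -{2}(halfK k); exact: coalition_matching.
Qed.

End Factorization.

Theorem proposition4p8 (n : nat) (n_even : ~~ odd n) (n_gt2 : 2 < n) :
  2 * (n - 1) <= edge_coalition_number (complete_graph n).
Proof.
case: n => [|[|p]] // in n_even n_gt2 *.
have p_even : ~~ odd p by rewrite /= negbK in n_even.
(* n > 2 only gives p > 0; parity excludes p = 1 *)
have p_gt1 : 1 < p by case: (p) p_even n_gt2 => [|[]].
have ec_parts := ec_partition_parts p_even p_gt1.
apply: leq_trans (leq_bigmax_cond _ ec_parts).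
rewrite (card_fibres (part_neq0 p_even p_gt1)).
by rewrite card_prod card_bool card_ord subn1.
Qed.
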